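(* Let $G=(V,E)$ be a finite simple connected graph, and let $F:\mathbb F_2^{V}\to \mathbb F_2^{V}$ be the map given by $F(s)=(1+s)(1+P_s)$, where $P_s(v)=\prod_{x\in N(v)}(1+s(x))$ for $v\in V$. For any $s\in\mathbb F_2^{V}$, the set $F(s)^{-1}(0)$ is a dominating set of $G$. Conversely, for every dominating set $D\subseteq V$ of $G$ there exists a configuration $s\in\mathbb F_2^{V}$ such that $F(s)^{-1}(0)=D$. In particular, there is a bijection between the set of configurations in the image of $F$ and the set of all dominating sets of $G$.
   Context: Graphs are undirected. $\mathbb F_2=\{0,1\}$ is the field with two elements and $\mathbb F_2^{V}$ is the set of functions (''configurations'') $V\to\mathbb F_2$, with pointwise addition and multiplication; $1$ denotes the constant function $1$. $N(v)=\{x\in V : vx\in E\}$ is the open neighborhood of $v$; empty products equal $1$. For a configuration $t$ and $i\in\{0,1\}$, $t^{-1}(i)=\{v\in V: t(v)=i\}$. A dominating set of $G$ is a subset $D\subseteq V$ such that every vertex not in $D$ is adjacent to a vertex in $D$. *)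

(* Defs.v *)
From HB Require Import structures.
From mathcomp Require Import all_boot all_order all_algebra.
Set Implicit Arguments.
Unset Strict Implicit.
Unset Printing Implicit Defensive.
Import GRing.Theory.
Local Open Scope ring_scope.

Record sgraph := SGraph {
  vertex :> finType;
  edge : rel vertex;
  edge_sym : symmetric edge;
  edge_irr : irreflexive edge }.

(* The empty graph is not excluded. *)
Definition connected_graph (G : sgraph) : Prop :=
  forall u v : G, connect (@edge G) u v.

Definition neigh (G : sgraph) (v : G) : {set G} := [set x | edge v x].

Definition dominating (G : sgraph) (D : {set G}) : bool :=
  [forall v, (v \notin D) ==> [exists x in D, edge v x]].

Notation config G := {ffun vertex G -> 'F_2}.

Definition P (G : sgraph) (s : config G) : config G :=
  [ffun v => \prod_(x in neigh v) (1 + s x)].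

(* The operations and the constant 1 are those of the pointwise ring of
   finite functions; see FE. *)
Definition F (G : sgraph) (s : config G) : config G := (1 + s) * (1 + P s).

Lemma FE (G : sgraph) (s : config G) (v : G) :
  F s v = (1 + s v) * (1 + \prod_(x in neigh v) (1 + s x)).
Proof. by rewrite !ffunE. Qed.

Definition fiber (G : sgraph) (t : config G) (i : 'F_2) : {set G} :=
  [set v | t v == i].

(* Main.v *)
(* In 'F_2, F s v = 1 exactly when s v = 0 and s x = 1 for some neighbour x of
   v; such an x satisfies F s x = 0, so the zeros of F s dominate. Conversely,
   if D is dominating, its indicator s satisfies F s = 1 + s. *)
Require Import Defs.
From mathcomp Require Import all_boot all_order all_algebra.
Import GRing.Theory.
Local Open Scope ring_scope.

Lemma F2_add1_eq0 (a : 'F_2) : (1 + a == 0) = (a != 0).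
Proof. by case: a => [[|[|[]]]]. Qed.

Lemma F2_eq (a b : 'F_2) : (a == 0) = (b == 0) -> a = b.
Proof.
by case: a b => [[|[|[]]] // ?] [[|[|[]]] // ?] // _; apply: val_inj.
Qed.

(** In a field a product is nonzero iff both factors are. Over ['F_2], the factor [1 + P s v] is
    nonzero iff the product [P s v] vanishes, that is, iff some factor [1 + s x] does. *)
Lemma notin_fiber_F (G : sgraph) (s : config G) (v : G) :
  (v \notin fiber (F s) 0) = (s v == 0) && [exists x, edge v x && (s x != 0)].
Proof.
rewrite inE FE mulf_eq0 negb_or !F2_add1_eq0 !negbK; congr (_ && _).
apply/prodf_eq0/existsP => [[x vx]|[x /andP[vx sx]]].
  by rewrite F2_add1_eq0 => sx; exists x; rewrite inE in vx; rewrite vx.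
by exists x; rewrite ?inE // F2_add1_eq0.
Qed.

Lemma dominating_fiber_F (G : sgraph) (s : config G) :
  dominating (fiber (F s) 0).
Proof.
apply/forallP => v; apply/implyP.
rewrite notin_fiber_F => /andP[_ /existsP[x /andP[vx sx]]].
apply/existsP; exists x; rewrite vx andbT -[_ \in _]negbK notin_fiber_F.
by rewrite (negbTE sx).
Qed.

(** On [D] the factor [1 + s v] is zero. Off [D], domination supplies a neighbour where the
    indicator is 1, so [F] takes the value 1. *)
Lemma fiber_F_indicator (G : sgraph) (D : {set G}) :
  dominating D -> fiber (F [ffun v => (v \in D)%:R]) 0 = D.
Proof.
move=> /forallP domD; apply/setP => v; apply: negb_inj.
rewrite notin_fiber_F ffunE; have := domD v; case: (v \in D) => //=.
by case/existsP => x /andP[xD vx]; apply/existsP; exists x; rewrite vx ffunE xD.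
Qed.

(** With only two values available, knowing where a configuration vanishes determines it. *)
Lemma fiber0_inj (G : sgraph) : injective (fun t : config G => fiber t 0).
Proof.
by move=> t u /setP tu; apply/ffunP => v; apply: F2_eq; have := tu v; rewrite !inE.
Qed.

Theorem corollary3p4 (G : sgraph) (connG : connected_graph G) :
  (forall s : config G, dominating (fiber (F s) 0)) /\
  (forall D : {set G}, dominating D ->
     exists s : config G, fiber (F s) 0 = D) /\
  (exists f : {t : config G | t \in [set F s | s : config G]} ->
              {D : {set G} | dominating D},
     bijective f).
Proof.
split; first exact: dominating_fiber_F.
split=> [D domD|]; first by eexists; exact: fiber_F_indicator domD.
have dom_im (t : {t : config G | t \in [set F s | s : config G]}) :
  dominating (fiber (val t) 0).
  by case: t => t /= /imsetP[s _ ->]; apply: dominating_fiber_F.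
have im_F (D : {D : {set G} | dominating D}) :
  F [ffun v => (v \in val D)%:R] \in [set F s | s : config G].
  exact: imset_f.
exists (fun t => exist _ (fiber (val t) 0) (dom_im t)).
exists (fun D : {D | dominating D} =>
          exist _ (F [ffun v => (v \in val D)%:R]) (im_F D)) => [t|D].
  (* A preimage of [t] under [F] need not be recovered: it suffices to compare zero fibers, and the
     fiber of [t] is dominating. *)
  by apply/val_inj/fiber0_inj; rewrite /= fiber_F_indicator ?dom_im.
by apply: val_inj; rewrite /= fiber_F_indicator //; apply: (valP D).
Qed.
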